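(* $$\sum_{n\ge0}S_n^{D,+}\frac{x^n}{n!}=\frac{2\cos^2x-\sin^2x}{2(\cos x-\sin x)},\qquad \sum_{n\ge0}S_n^{D,-}\frac{x^n}{n!}=\frac{\sin^2x}{2(\cos x-\sin x)},$$ $$\sum_{n\ge0}S_n^{B-D,+}\frac{x^n}{n!}=\sum_{n\ge0}S_n^{B-D,-}\frac{x^n}{n!}=\frac{\sin^2x}{2(\cos x-\sin x)}.$$
   Context: $\mathfrak{B}_n$ is the group of signed permutations in window notation $\pi=\pi_1\cdots\pi_n$, and $\mathfrak{D}_n$ the subset with an even number of negative entries. For $\pi\in\mathfrak{B}_n$, $\mathrm{inv}_D(\pi)=|\{i<j:\pi_i>\pi_j\}|+|\{i<j:-\pi_i>\pi_j\}|$. A snake is $\pi\in\mathfrak{B}_n$ with $0<\pi_1>\pi_2<\pi_3>\cdots$. For $n\ge1$, $S_n^{D,\pm}$ is the number of snakes in $\mathfrak{D}_n$ with $\mathrm{inv}_D$ even ($+$) or odd ($-$), and $S_n^{B-D,\pm}$ the number of snakes in $\mathfrak{B}_n\setminus\mathfrak{D}_n$ with $\mathrm{inv}_D$ even ($+$) or odd ($-$). Conventions: $S_0^{D,+}=1$, $S_0^{D,-}=S_0^{B-D,+}=S_0^{B-D,-}=0$. *)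

(* Defs.v *)
From HB Require Import structures.
From mathcomp Require Import all_boot all_order all_fingroup all_algebra.
From mathcomp Require Import boolp.

Set Implicit Arguments.
Unset Strict Implicit.
Unset Printing Implicit Defensive.

Import Order.TTheory GRing.Theory Num.Theory.
Local Open Scope ring_scope.

(* The generating-function identities are read in the ring Q[[x]] of formal   *)
(* power series.  [fps K] is K[[x]] with the Cauchy product; a series is a    *)
(* unit iff its constant term is nonzero, and then [f^-1] is its inverse.     *)
(* MathComp rings are choice types, which for series needs classical choice.  *)
Record fps (K : Type) := Fps { fcoef :> nat -> K }.

Lemma fpsP (K : Type) (f g : fps K) : f =1 g -> f = g.
Proof. by case: f => f; case: g => g /= /funext ->. Qed.

HB.instance Definition _ (K : Type) := gen_eqMixin (fps K).
HB.instance Definition _ (K : Type) := gen_choiceMixin (fps K).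

Section FpsRing.
Variable K : fieldType.
Implicit Types f g h : fps K.

Definition fps_zero : fps K := Fps (fun _ => 0).
Definition fps_opp f : fps K := Fps (fun n => - f n).
Definition fps_add f g : fps K := Fps (fun n => f n + g n).

Fact fps_addA : associative fps_add.
Proof. by move=> f g h; apply: fpsP => n /=; rewrite addrA. Qed.
Fact fps_addC : commutative fps_add.
Proof. by move=> f g; apply: fpsP => n /=; rewrite addrC. Qed.
Fact fps_add0 : left_id fps_zero fps_add.
Proof. by move=> f; apply: fpsP => n /=; rewrite add0r. Qed.
Fact fps_addN : left_inverse fps_zero fps_opp fps_add.
Proof. by move=> f; apply: fpsP => n /=; rewrite addNr. Qed.

HB.instance Definition _ :=
  GRing.isZmodule.Build (fps K) fps_addA fps_addC fps_add0 fps_addN.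

Definition fps_one : fps K := Fps (fun n => (n == 0)%:R).
Definition fps_mul f g : fps K :=
  Fps (fun n => \sum_(i < n.+1) f i * g (n - i)%N).

Let trunc m f : {poly K} := \poly_(i < m.+1) f i.

Let truncE m f i : (i <= m)%N -> (trunc m f)`_i = f i.
Proof. by move=> le_im; rewrite coef_poly ltnS le_im. Qed.

Let fps_mulE m f g n : (n <= m)%N ->
  fps_mul f g n = (trunc m f * trunc m g)`_n.
Proof.
move=> le_nm; rewrite coefM; apply: eq_bigr => i _.
by rewrite !truncE // (leq_trans _ le_nm) ?leq_subr // -ltnS.
Qed.

Fact fps_mulA : associative fps_mul.
Proof.
move=> f g h; apply: fpsP => n.
transitivity ((trunc n f * (trunc n g * trunc n h))`_n).
  rewrite coefM; apply: eq_bigr => i _; rewrite truncE -1?ltnS //.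
  by rewrite (@fps_mulE n) ?leq_subr.
rewrite mulrA coefM; apply: eq_bigr => i _.
by rewrite -fps_mulE -1?ltnS // truncE ?leq_subr.
Qed.

Fact fps_mulC : commutative fps_mul.
Proof.
by move=> f g; apply: fpsP => n; rewrite !(@fps_mulE n) // mulrC.
Qed.

Fact fps_mul1 : left_id fps_one fps_mul.
Proof.
move=> f; apply: fpsP => n /=; rewrite big_ord_recl /= mul1r subn0.
by rewrite big1 ?addr0 // => i _; rewrite mul0r.
Qed.

Fact fps_mulDl : left_distributive fps_mul fps_add.
Proof.
move=> f g h; apply: fpsP => n /=; rewrite -big_split /=.
by apply: eq_bigr => i _; rewrite mulrDl.
Qed.

Fact fps_one_neq0 : fps_one != 0.
Proof.
by apply/eqP => /(congr1 (fun f : fps K => f 0)) /eqP; rewrite /= oner_eq0.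
Qed.

HB.instance Definition _ := GRing.Zmodule_isComNzRing.Build (fps K)
  fps_mulA fps_mulC fps_mul1 fps_mulDl fps_one_neq0.

Lemma fcoef0 n : (0 : fps K) n = 0. Proof. by []. Qed.
Lemma fcoef1 n : (1 : fps K) n = (n == 0)%:R. Proof. by []. Qed.
Lemma fcoefD f g n : (f + g) n = f n + g n. Proof. by []. Qed.
Lemma fcoefN f n : (- f) n = - f n. Proof. by []. Qed.
Lemma fcoefM f g n : (f * g) n = \sum_(i < n.+1) f i * g (n - i)%N.
Proof. by []. Qed.
Lemma fcoef_sum I (r : seq I) (P : pred I) (F : I -> fps K) n :
  (\sum_(i <- r | P i) F i) n = \sum_(i <- r | P i) F i n.
Proof. by elim/big_rec2: _ => // i x y _ <-. Qed.

Definition fps_scale (a : K) f : fps K := Fps (fun n => a * f n).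

(* If f = a (1 - u) with a != 0 and u without constant term, the inverse of f *)
(* is a^-1 (1 + u + u^2 + ...), where u^k only affects degrees >= k.          *)
Definition fps_unit : {pred fps K} := fun f => f 0 != 0.
Definition fps_inv f : fps K :=
  if f 0 != 0 then
    let u := 1 - fps_scale (f 0)^-1 f in
    Fps (fun n => (f 0)^-1 * \sum_(k < n.+1) (u ^+ k) n)
  else f.

Let fps_exp_low (u : fps K) k n : u 0 = 0 -> (n < k)%N -> (u ^+ k) n = 0.
Proof.
move=> u0; elim: k n => // k IHk n lt_nk.
rewrite exprS fcoefM big_ord_recl u0 mul0r add0r big1 // => -[i lt_i] _ /=.
rewrite /bump leq0n add1n IHk ?mulr0 //.
by case: n lt_nk lt_i => // n lt_nk lt_i; rewrite subSS (leq_ltn_trans (leq_subr _ _)).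
Qed.

Fact fps_mulVx : {in fps_unit, left_inverse 1 fps_inv *%R}.
Proof.
move=> f f0; rewrite unfold_in /= in f0; rewrite mulrC.
rewrite /fps_inv f0; set u := 1 - _; set a := f 0.
have u0 : u 0 = 0 by rewrite fcoefD fcoefN /= mulVf // subrr.
apply: fpsP => n; pose V := \sum_(k < n.+1) u ^+ k.
have invE i : (i <= n)%N -> \sum_(k < i.+1) (u ^+ k) i = V i.
  move=> le_in; rewrite /V fcoef_sum.
  rewrite -(big_mkord xpredT (fun k => (u ^+ k) i)).
  rewrite -[RHS](big_mkord xpredT (fun k => (u ^+ k) i)).
  rewrite [RHS](big_cat_nat (n := i.+1)) //= [X in _ + X]big_nat_cond.
  by rewrite [X in _ + X]big1 ?addr0 // => k /andP[/andP[ltik _] _]; apply: fps_exp_low.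
transitivity (((1 - u) * V) n).
  rewrite !fcoefM; apply: eq_bigr => i _.
  rewrite /= invE ?leq_subr // mulrA; congr (_ * _).
  by rewrite opprD opprK addrA subrr add0r mulrC.
rewrite -opprB mulNr -subrX1 opprB fcoefD fcoefN.
by rewrite fps_exp_low // subr0.
Qed.

Fact fps_unitPl f g : g * f = 1 -> fps_unit f.
Proof.
move=> /(congr1 (fun h : fps K => h 0)).
rewrite fcoefM big_ord1 fcoef1 /= => gf1; rewrite /fps_unit.
by apply: contra_eq_neq gf1 => ->; rewrite mulr0 eq_sym oner_eq0.
Qed.

Fact fps_inv_out : {in [predC fps_unit], fps_inv =1 id}.
Proof. by move=> f; rewrite inE unfold_in /fps_inv => /negbTE ->. Qed.

HB.instance Definition _ := GRing.ComNzRing_hasMulInverse.Build (fps K)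
  fps_mulVx fps_unitPl fps_inv_out.

Lemma fps_unitE f : (f \is a GRing.unit) = (f 0 != 0).
Proof. by []. Qed.

End FpsRing.

Definition fps_cos : fps rat :=
  Fps (fun n => if odd n then 0 else (-1) ^+ n./2 / (n`!)%:R).
Definition fps_sin : fps rat :=
  Fps (fun n => if odd n then (-1) ^+ n./2 / (n`!)%:R else 0).

Definition egf (a : nat -> nat) : fps rat :=
  Fps (fun n => (a n)%:R / (n`!)%:R).

Lemma egf_denom_unit : 2 * (fps_cos - fps_sin) \is a GRing.unit.
Proof. by rewrite fps_unitE fcoefM big_ord1. Qed.

(* A signed permutation is given by the absolute values and the signs of its  *)
(* window; positions are 0-based ('I_n) and values are 1-based.               *)
Definition signed_perm (n : nat) : finType := ('S_n * {ffun 'I_n -> bool})%type.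

Definition window n (p : signed_perm n) (i : 'I_n) : int :=
  (-1) ^+ p.2 i * (p.1 i).+1%:Z.

Lemma absz_window n (p : signed_perm n) i : `|window p i|%N = (p.1 i).+1.
Proof. by rewrite /window abszMsign. Qed.

Lemma window_lt0 n (p : signed_perm n) i : (window p i < 0) = p.2 i.
Proof. by rewrite /window; case: (p.2 i). Qed.

Lemma window_inj n (p q : signed_perm n) : window p =1 window q -> p = q.
Proof.
case: p => s e; case: q => t d eq_w; congr (_, _).
  apply/permP => i; apply/val_inj; apply: succn_inj.
  by rewrite -(absz_window (s, e)) eq_w absz_window.
by apply/ffunP => i; rewrite -(window_lt0 (s, e)) eq_w window_lt0.
Qed.

Lemma window_surj n (w : 'I_n -> int) :
    injective (fun i => `|w i|%N) -> (forall i, (0 < `|w i| <= n)%N) ->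
  exists p : signed_perm n, window p =1 w.
Proof.
move=> injw wn.
have lt_w i : (`|w i|.-1 < n)%N by have /andP[w0] := wn i; rewrite prednK.
have inj_s : injective (fun i => Ordinal (lt_w i)).
  move=> i j [] eq_ij; apply: injw => /=; have /andP[wi _] := wn i.
  by have /andP[wj _] := wn j; rewrite -(prednK wi) eq_ij prednK.
exists (perm inj_s, [ffun i => w i < 0]) => i.
rewrite /window ffunE permE /= prednK; last by have /andP[] := wn i.
by rewrite -intEsign.
Qed.

Definition typeD n (p : signed_perm n) : bool :=
  ~~ odd #|[set i : 'I_n | window p i < 0]|.

Definition invD n (p : signed_perm n) : nat :=
  (#|[set ij : 'I_n * 'I_n | (ij.1 < ij.2)%N &&
        (window p ij.2 < window p ij.1)%R]| +
   #|[set ij : 'I_n * 'I_n | (ij.1 < ij.2)%N &&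
        (window p ij.2 < - window p ij.1)%R]|)%N.

(* 0 < p_1 > p_2 < p_3 > ...: with 0-based positions, descents at even i.     *)
Definition snake n (p : signed_perm n) : bool :=
  [forall i : 'I_n, (i == 0%N :> nat) ==> (0 < window p i)] &&
  [forall i : 'I_n, forall j : 'I_n, (j == i.+1 :> nat) ==>
     (if odd i then window p i < window p j else window p j < window p i)].

Definition S_D_plus (n : nat) : nat :=
  #|[set p : signed_perm n | [&& snake p, typeD p & ~~ odd (invD p)]]|.
Definition S_D_minus (n : nat) : nat :=
  #|[set p : signed_perm n | [&& snake p, typeD p & odd (invD p)]]|.
Definition S_BD_plus (n : nat) : nat :=
  #|[set p : signed_perm n | [&& snake p, ~~ typeD p & ~~ odd (invD p)]]|.
Definition S_BD_minus (n : nat) : nat :=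
  #|[set p : signed_perm n | [&& snake p, ~~ typeD p & odd (invD p)]]|.

(* At n = 0 the empty window is a snake of type D with invD = 0, which gives  *)
(* the usual conventions.                                                     *)
Lemma S_at0 : [/\ S_D_plus 0 = 1%N, S_D_minus 0 = 0%N,
                  S_BD_plus 0 = 0%N & S_BD_minus 0 = 0%N].
Proof.
have A0 (A : {set 'I_0}) : #|A| = 0%N by rewrite (eq_card0 (A := A)) // => -[].
have B0 (A : {set 'I_0 * 'I_0}) : #|A| = 0%N.
  by rewrite (eq_card0 (A := A)) // => -[[]].
have sn (p : signed_perm 0) : snake p.
  by apply/andP; split; apply/forallP => -[].
have tD (p : signed_perm 0) : typeD p by rewrite /typeD A0.
have iD (p : signed_perm 0) : invD p = 0%N by rewrite /invD !B0.
split; last 3 first.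
- by apply: eq_card0 => p; rewrite inE iD /= !andbF.
- by apply: eq_card0 => p; rewrite inE tD /= !andbF.
- by apply: eq_card0 => p; rewrite inE tD /= !andbF.
rewrite /S_D_plus (eq_card (B := predT)) => [|p]; last by rewrite !inE sn tD iD.
by rewrite card_prod card_Sn card_ffun card_ord.
Qed.

(* Main.v *)
(* Put u_i = (-1)^i pi_i. Then pi is a snake iff u_0 > 0 and u_i + u_(i+1) > 0 *)
(* for all i: an entry with a neighbour of smaller absolute value (a 0 being    *)
(* placed in front of the word) has a prescribed sign, and the signs of the     *)
(* others, the valleys of |pi|, are free. Moreover inv_D(pi) has the parity of  *)
(* the permutation |pi|. The four numbers are then linear combinations of the   *)
(* sums over snakes of 1, (-1)^neg, sgn |pi| and (-1)^neg sgn |pi|.             *)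
(* With (-1)^neg, the free signs cancel unless |pi| has no valley, that is      *)
(* |pi| = id, and the sum is (-1)^(n/2), the coefficient of cos + sin.          *)
(* The sum of sgn(s) 2^val(s) over s in S_n is also (-1)^(n/2): exchanging the  *)
(* two largest values keeps the valleys unless they are the last two entries,   *)
(* where one of the two orders has one more valley.                             *)
(* Finally, inserting n into s in S_(n-1) with k valleys gives k valleys in     *)
(* 2k + 1 places and k + 1 valleys in the others. So does d/dx act on           *)
(* S (1 + T^2)^k T^(n-1-2k) when S' = S T and T' = 1 + T^2, whence              *)
(* S = 1 / (cos - sin) has the exponential coefficients sum_s 2^val(s).         *)
Require Import Defs.
From mathcomp Require Import all_boot all_order all_fingroup all_algebra.
From mathcomp Require Import zify ring.
Set Implicit Arguments.
Unset Strict Implicit.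
Unset Printing Implicit Defensive.
Import Order.TTheory GRing.Theory Num.Theory.
Local Open Scope ring_scope.

(** The signs (-1)^neg and (-1)^inv_D split the snakes into four classes. By orthogonality, four
    times the size of a class is A + cB + dC + cdE with c and d equal to 1 or -1, where A, B, C, E
    are the sums over snakes of 1, of either sign and of their product ([card_snakes],
    [sum_sgn_snakes]). By [snakeE] the snakes over a permutation are the free choices of sign at its
    valleys, and by [odd_invD] the second sign is that of the permutation. So A is the sum of 2^val,
    found in [sum_valleys] from the derivatives of 1 / (cos - sin), while B, C, E all equal
    (-1)^floor(n/2) ([sum_signed_snakes], [signed_valleys]). Since c + d + cd is 3 for c = d = 1 and
    -1 otherwise, three of the four series coincide. *)

(** * Permutations as words, and insertion of a letter *)

Lemma lift_perm_inj n (i j : 'I_n.+1) : injective (@lift_perm n i j).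
Proof.
move=> s t eq_st; apply/permP=> k; apply: (@lift_inj _ j).
by rewrite -!(@lift_perm_lift _ i) eq_st.
Qed.

Lemma lift_perm_surj n (i j : 'I_n.+1) (s : 'S_n.+1) :
  s i = j -> exists t, s = lift_perm i j t.
Proof.
move=> sij; pose g k := odflt k (unlift j (s (lift i k))).
have gE k : lift j (g k) = s (lift i k).
  rewrite /g; have := neq_lift i k.
  by rewrite -(inj_eq (@perm_inj _ s)) sij => /unlift_some[? -> ->].
have inj_g : injective g.
  by move=> k l /(congr1 (lift j)); rewrite !gE => /perm_inj /lift_inj.
exists (perm inj_g); apply/permP=> k; case: (unliftP i k) => [k'|] ->.
  by rewrite lift_perm_lift permE gE.
by rewrite lift_perm_id.
Qed.

Lemma big_lift_perm (R : nmodType) n (i j : 'I_n.+1) (P : pred 'S_n.+1)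
    (F : 'S_n.+1 -> R) :
  \sum_(s : 'S_n.+1 | (s i == j) && P s) F s =
  \sum_(t | P (lift_perm i j t)) F (lift_perm i j t) :> R.
Proof.
transitivity (\sum_(s in lift_perm i j @: [set t | P (lift_perm i j t)]) F s).
  apply: eq_bigl => s; apply/andP/imsetP => [[/eqP/lift_perm_surj[t ->] Pt]|].
    by exists t; rewrite ?inE.
  by case=> t; rewrite inE => Pt ->; rewrite lift_perm_id eqxx.
rewrite big_imset /=; last by move=> s t _ _; apply: lift_perm_inj.
by apply: eq_bigl => t; rewrite inE.
Qed.

Lemma big_perm_lift_max (R : nmodType) n (F : 'S_n.+1 -> R) :
  \sum_s F s = \sum_(t : 'S_n) \sum_i F (lift_perm i ord_max t).
Proof.
rewrite (partition_big (fun s : 'S_n.+1 => s^-1%g ord_max) predT) //=.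
rewrite exchange_big; apply: eq_bigr => i _.
rewrite -(big_lift_perm i ord_max xpredT); apply: eq_bigl => s.
by rewrite andbT (can2_eq (permKV s) (permK s)) eq_sym.
Qed.

Definition word n (s : 'S_n) : seq nat := [seq val (s i) | i <- enum 'I_n].

Lemma size_word n (s : 'S_n) : size (word s) = n.
Proof. by rewrite size_map size_enum_ord. Qed.

Lemma nth_word n (s : 'S_n) (i : 'I_n) : nth 0%N (word s) i = s i.
Proof. by rewrite (nth_map i) ?size_enum_ord // nth_ord_enum. Qed.

Lemma word_lt n (s : 'S_n) : all (gtn n) (word s).
Proof. by apply/allP=> _ /mapP[i _ ->] /=. Qed.

Definition insert_at i (M : nat) w := take i w ++ M :: drop i w.

Lemma nth_insert_at i M w k : (i <= size w)%N ->
  nth 0%N (insert_at i M w) k =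
  if k == i then M else if (k < i)%N then nth 0%N w k else nth 0%N w k.-1.
Proof.
move=> le_i; rewrite nth_cat size_takel //; case: ltngtP => [lt_k|lt_k|->].
- by rewrite nth_take.
- case: k lt_k => // k lt_k; rewrite subSn //= nth_drop; congr nth; lia.
- by rewrite subnn.
Qed.

Lemma word_lift_perm n (i j : 'I_n.+1) (s : 'S_n) :
  word (lift_perm i j s) = insert_at i j [seq bump j k | k <- word s].
Proof.
have le_i : (i <= size [seq bump j k | k <- word s])%N.
  by rewrite size_map size_word -ltnS.
apply: (@eq_from_nth _ 0%N) => [|k].
  rewrite size_cat /= size_takel // size_drop size_map !size_word addnS subnKC //.
  by rewrite -ltnS.
rewrite size_word => lt_k; rewrite nth_insert_at //.
rewrite -[k]/(val (Ordinal lt_k)) nth_word /=.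
case: (unliftP i (Ordinal lt_k)) => [k'|] /(congr1 val) /= ek.
  have -> : Ordinal lt_k = lift i k' by apply: val_inj.
  rewrite lift_perm_lift /=; move: ek; rewrite {1}/bump.
  case: (leqP i k') => [le_ik|lt_ki] ->.
    rewrite add1n gtn_eqF ?ltnS // ltnNge leqW //=.
    by rewrite (nth_map 0%N) ?size_word ?nth_word.
  rewrite add0n ltn_eqF //=.
  by rewrite lt_ki (nth_map 0%N) ?size_word ?nth_word.
have -> : Ordinal lt_k = i by apply: val_inj.
by rewrite lift_perm_id ek eqxx.
Qed.

Lemma bump_word n m (s : 'S_n) :
  (n <= m)%N -> [seq bump m k | k <- word s] = word s.
Proof.
move=> le_nm; rewrite -[RHS]map_id.
apply/eq_in_map => k /(allP (word_lt s)) /= lt_k.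
by rewrite /bump leqNgt (leq_trans lt_k).
Qed.

(** * Valleys, and the effect of inserting the maximum *)

(* A valley is an entry smaller than its neighbours, where 0 is placed before *)
(* the word and infinity after it. *)
Definition valley w i := [&& (0 < i)%N, (nth 0 w i < nth 0 w i.-1)%N &
  ~~ ((i.+1 < size w)%N && (nth 0 w i.+1 < nth 0 w i)%N)].

(* [d] tells whether [x], the entry preceding [w], ends a descent. *)
Fixpoint valleys_from (d : bool) x w : nat :=
  if w is y :: w' then (d && ~~ (y < x)%N) + valleys_from (y < x)%N y w' else d.

Definition valleys w := valleys_from false 0 w.

(** The first summand settles [x] itself, whose status waits for the next letter; the sum runs over
    the letters of [w]. *)
Lemma valleys_fromE d x w : valleys_from d x w =
  (d && ~~ ((0 < size w)%N && (nth 0 w 0 < x)%N) +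
    \sum_(i < size w) valley (x :: w) i.+1)%N.
Proof.
elim: w d x => [|y w IHw] d x; first by rewrite big_ord0 andbT addn0.
rewrite /= IHw big_ord_recl; congr (_ + (_ + _))%N.
Qed.

Lemma valleysE w : valleys w = (\sum_(i < size w) valley w i)%N.
Proof.
by case: w => [|x w]; rewrite ?big_ord0 // big_ord_recl /valleys /= valleys_fromE.
Qed.

Lemma valleys_from_true x w :
  valleys_from true x w =
  (valleys_from false x w + ~~ ((0 < size w) && (nth 0 w 0 < x)))%N.
Proof. by case: w => [|y w] //=; case: ltnP => /=; lia. Qed.

(** The number of valleys is kept exactly when the maximum goes next to a peak or at the end.
    Between 0 in front and infinity behind there are as many peaks as valleys, whence 2k + 1 such
    places. The corrections remove those lying before [w]: both sides of an earlier peak if [d], the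
    left side of [x] if [x] is itself a peak. *)
Lemma sum_insert_max_from (R : nmodType) (f : nat -> R) d x M w :
    (x <= M)%N -> all (gtn M) w ->
  let k := valleys_from d x w in
  exists a b : nat, [/\
    \sum_(i < (size w).+1) f (valleys_from d x (insert_at i M w)) =
      f k *+ a + f k.+1 *+ b,
    (a + b = (size w).+1)%N &
    (a + d.*2 + (~~ d && ((0 < size w) && (nth 0 w 0 < x))) = k.*2.+1)%N].
Proof.
elim: w d x f => [|y w IHw] d x f le_xM /=.
  move=> _; exists 1%N, 0%N; rewrite big_ord1 /insert_at /=.
  by rewrite ltnNge le_xM /= andbT addn0 mulr1n mulr0n addr0; split=> //; lia.
case/andP=> lt_yM lt_wM.
set c := (d && ~~ (y < x)%N).
have [a [b [IHs IHab IHa]]] :=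
  IHw (y < x)%N y (fun k => f (c + k)%N) (ltnW lt_yM) lt_wM.
rewrite big_ord_recl; under eq_bigr => i _ do rewrite /insert_at /= -/c.
rewrite IHs {1}/insert_at /=.
rewrite ltnNge le_xM lt_yM /= andbT add0n addnS.
(* [e] tells whether the one remaining place, right before [y], creates a valley. *)
suff [e -> ea] : exists2 e : bool, (d + valleys_from true y w =
    c + valleys_from (y < x)%N y w + e)%N &
    (a + d.*2 + ~~ e + (~~ d && (y < x)) = (c + valleys_from (y < x) y w).*2.+1)%N.
  case: e ea => ea; rewrite ?addn1 ?addn0.
    exists a, b.+1; split; [by rewrite mulrS addrCA | lia | lia].
  by exists a.+1, b; split; [by rewrite mulrS addrA | lia | lia].
clear IHs IHab; move: IHa; rewrite /c.
case: (ltnP y x) => _ /=; rewrite valleys_from_true;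
  set q := (_ && _); case: d @c => /=.
  by exists true; lia.
  by exists false; lia.
  by exists (~~ q); lia.
  by exists (~~ q); lia.
Qed.
Lemma valleys_lift_perm_max n (i : 'I_n.+1) (s : 'S_n) :
  valleys (word (lift_perm i ord_max s)) = valleys (insert_at i n (word s)).
Proof. by rewrite word_lift_perm bump_word. Qed.

(** The bound on [k] makes [n - k.*2] a true difference. *)
Lemma sum_valleys_lift_max (R : nmodType) (f : nat -> R) n (s : 'S_n) :
  let k := valleys (word s) in (k.*2 <= n)%N /\
  \sum_i f (valleys (word (lift_perm i ord_max s))) =
    f k *+ k.*2.+1 + f k.+1 *+ (n - k.*2).
Proof.
move=> k; have [a [b []]] := sum_insert_max_from f false (leq0n n) (word_lt s).
rewrite -/(valleys (word s)) -/k ltn0 !andbF addn0 size_word => sumE ab ak.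
rewrite double0 addn0 in ak.
split; first by lia.
under eq_bigr do rewrite valleys_lift_perm_max.
by rewrite sumE ak (_ : b = (n - k.*2)%N) //; lia.
Qed.

(** * Permutations without valleys *)

Lemma word_inj n : injective (@word n).
Proof.
by move=> s t wst; apply/permP=> i; apply/val_inj; rewrite /= -!nth_word wst.
Qed.

Lemma word1 n : word (1%g : 'S_n) = iota 0 n.
Proof. by rewrite -val_enum_ord; apply: eq_map => i; rewrite perm1. Qed.

Lemma uniq_word n (s : 'S_n) : uniq (word s).
Proof. by rewrite map_inj_uniq ?enum_uniq // => i j /val_inj /perm_inj. Qed.

Lemma mem_word n (s : 'S_n) : word s =i iota 0 n.
Proof.
move=> k; rewrite mem_iota add0n /=; apply/idP/idP => [/(allP (word_lt s))|] //.
move=> lt_k; apply/mapP; exists ((s^-1)%g (Ordinal lt_k)); rewrite ?mem_enum //.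
by rewrite permKV.
Qed.

(** A descent that does not end in a valley is followed by another descent; since infinity stands
    behind the word, this cannot go on, so without valleys the word increases. *)
Lemma valleys_eq0 n (s : 'S_n) : (valleys (word s) == 0%N) = (s == 1%g).
Proof.
rewrite valleysE sum_nat_eq0 -(inj_eq (@word_inj n)) word1.
apply/forallP/eqP => [no_valley | -> i]; last first.
  have lt_i : (i < n)%N by rewrite -[n in (_ < n)%N](size_iota 0).
  rewrite /valley (nth_iota _ _ lt_i).
  rewrite (nth_iota _ _ (leq_ltn_trans (leq_pred i) lt_i)).
  by rewrite !add0n (ltnNge i) leq_pred andbF.
apply: (irr_sorted_eq ltn_trans ltnn); [|exact: iota_ltn_sorted|exact: mem_word].
apply/(sortedP 0%N) => i lt_i; rewrite ltnNge; apply/negP=> le_w.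
have {le_w} : (nth 0 (word s) i.+1 < nth 0 (word s) i)%N.
  by rewrite ltn_neqAle le_w nth_uniq ?uniq_word // ?(ltnW lt_i) // gtn_eqF.
have [m] := ubnP (n - i)%N; elim: m i lt_i => // m IHm i lt_i le_m desc.
have := no_valley (Ordinal lt_i); rewrite /valley /= desc /= eqb0 negbK.
case/andP=> lt_i2; apply: IHm => //; move: lt_i2; rewrite size_word; lia.
Qed.

(** * The signed sum of 2^val *)

Section SignedValleys.
Variable n : nat.

(** [top1] and [top2] serve both as the two largest values and as the last two positions. *)
Let top1 : 'I_n.+2 := ord_max.
Let top2 : 'I_n.+2 := lift ord_max ord_max.
Let swap : 'S_n.+2 := tperm top1 top2.
Let swapn k := if k == n then n.+1 else if k == n.+1 then n else k.
Let tops_last (s : 'S_n.+2) := (n <= s top1)%N && (n <= s top2)%N.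

Let top2E : top2 = n :> nat.
Proof. by rewrite /= /bump leqNgt ltnSn. Qed.

Let swapE k : swap k = swapn k :> nat.
Proof.
rewrite /swap /swapn; case: tpermP => [->|->|ne1 ne2].
- by rewrite top2E /= gtn_eqF ?eqxx.
- by rewrite top2E eqxx.
rewrite !ifF //; apply/negbTE/eqP => ek.
  by apply: ne1; apply: ord_inj.
by apply: ne2; apply: ord_inj; rewrite top2E.
Qed.

Let word_swap s : word (s * swap)%g = map swapn (word s).
Proof. by rewrite -map_comp; apply: eq_map => i /=; rewrite permM swapE. Qed.

Let swapn_ge k : (n <= swapn k)%N = (n <= k)%N.
Proof.
by rewrite /swapn; case: eqVneq => [->|_]; last case: eqVneq => [->|]; lia.
Qed.

Let tops_last_swap s : tops_last (s * swap)%g = tops_last s.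
Proof. by rewrite /tops_last !permM !swapE !swapn_ge. Qed.

(** A valley of value at least [n] has a larger predecessor, so the two are [n] and [n.+1]; nothing
    larger is left to follow, so they end the word. *)
Let valley_low s i : ~~ tops_last s -> (i < n.+2)%N -> valley (word s) i ->
  (nth 0 (word s) i < n)%N.
Proof.
move=> ntop lt_i; rewrite /valley size_word => /and3P[i_gt0 desc /nandP asc].
rewrite ltnNge; apply/negP=> ge_n; case/negP: ntop.
have lt_w k : (k < n.+2)%N -> (nth 0 (word s) k < n.+2)%N.
  by move=> lt_k; apply: (allP (word_lt s)); rewrite mem_nth ?size_word.
have lt_pi : (i.-1 < n.+2)%N by lia.
have wi : nth 0%N (word s) i = n by have := lt_w _ lt_pi; lia.
have wpi : nth 0%N (word s) i.-1 = n.+1 by have := lt_w _ lt_pi; lia.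
have last_i : i = n.+1.
  apply/eqP; rewrite eqn_leq -ltnS lt_i leqNgt; apply/negP=> lt_i1.
  case: asc => [/negP//|]; rewrite -leqNgt wi => ge_n1.
  have neq k : (k < n.+2)%N -> k != i.+1 ->
      nth 0%N (word s) i.+1 <> nth 0%N (word s) k.
    move=> lt_k ne_k /eqP; rewrite nth_uniq ?uniq_word ?size_word //.
    by rewrite eq_sym (negbTE ne_k).
  have := neq i lt_i; have := neq i.-1 lt_pi; have := lt_w i.+1 lt_i1.
  by rewrite wi wpi; lia.
rewrite /tops_last -!nth_word top2E (_ : nat_of_ord top1 = i) // ge_n.
by move: wpi; rewrite last_i /= => ->; apply: leqnSn.
Qed.

(** The valley is below [n], and comparisons with such a value do not see the exchange of [n] and
    [n.+1]. *)
Let valley_swap s i : ~~ tops_last s -> (i < n.+2)%N ->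
  valley (word s) i -> valley (word (s * swap)%g) i.
Proof.
move=> ntop lt_i v_i; have lt_n := valley_low ntop lt_i v_i.
have fix_low k : (k < n)%N -> swapn k = k.
  by move=> lt_k; rewrite /swapn !ltn_eqF // ltnW.
have swap_gt k x : (k < n)%N -> (k < swapn x)%N = (k < x)%N.
  by rewrite /swapn; case: eqVneq => [->|_]; last case: eqVneq => [->|]; lia.
have swap_lt k x : (k < n)%N -> (swapn x < k)%N = (x < k)%N.
  by rewrite /swapn; case: eqVneq => [->|_]; last case: eqVneq => [->|]; lia.
have nthE k : (k < n.+2)%N ->
    nth 0%N (word (s * swap)%g) k = swapn (nth 0%N (word s) k).
  by move=> lt_k; rewrite word_swap (nth_map 0%N) ?size_word.
case/and3P: v_i => i_gt0 desc asc; rewrite /valley i_gt0 size_word /=.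
have lt_pi : (i.-1 < n.+2)%N by lia.
rewrite (nthE i) // (nthE i.-1) // fix_low // swap_gt // desc /=.
apply: contra asc => /andP[lt_i1]; rewrite nthE // swap_lt // => ->.
by rewrite size_word lt_i1.
Qed.

Let valleys_swap s :
  ~~ tops_last s -> valleys (word (s * swap)%g) = valleys (word s).
Proof.
move=> ntop; rewrite !valleysE !size_word; apply: eq_bigr => i _; congr nat_of_bool.
apply/idP/idP; last exact: valley_swap.
rewrite -tops_last_swap in ntop.
by move/(valley_swap ntop (ltn_ord i)); rewrite -mulgA tperm2 mulg1.
Qed.

Let weight m (s : 'S_m) : rat := (-1) ^+ s * 2 ^+ valleys (word s).

Let odd_swap s : odd_perm (s * swap)%g = ~~ odd_perm s.
Proof. by rewrite odd_permM odd_tperm neq_lift addbT. Qed.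

(** Multiplication by [swap] permutes these terms and reverses their signs. *)
Let sum_not_tops : \sum_(s | ~~ tops_last s) weight s = 0.
Proof.
suff : \sum_(s | ~~ tops_last s) weight s = - \sum_(s | ~~ tops_last s) weight s.
  by move/eqP; rewrite -subr_eq0 opprK -mulr2n mulrn_eq0 => /eqP.
rewrite {1}(reindex_inj (mulIg swap)) -sumrN.
apply: eq_big => s; rewrite tops_last_swap // => ntop.
by rewrite /weight valleys_swap // odd_swap signrN mulNr.
Qed.

(** The first large letter settles the letter before it just as infinity would; afterwards only the
    order [n.+1], [n] creates a valley. *)
Let valleys_from_tops d x w : (x <= n)%N -> all (gtn n) w ->
  valleys_from d x (w ++ [:: n; n.+1]) = valleys_from d x w /\
  valleys_from d x (w ++ [:: n.+1; n]) = (valleys_from d x w).+1.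
Proof.
elim: w d x => [|y w IHw] d x le_x /=.
  by rewrite ltnS leqnn leqNgt !ltnNge !leqW //= le_x; case: d.
by case/andP=> /ltnW /(IHw (y < x)%N) /[apply]-[-> ->]; rewrite addnS.
Qed.

(** Deleting the last two letters leaves a permutation [r]. The increasing order contributes the
    weight of [r], the decreasing one -2 times it: one more inversion and one more valley. *)
Let sum_tops : \sum_(s | tops_last s) weight s = - \sum_(r : 'S_n) weight r.
Proof.
have insert_max (m : nat) j w : size w = m -> insert_at m j w = w ++ [:: j].
  by move=> <-; rewrite /insert_at take_size drop_size.
rewrite (bigID (fun s : 'S_n.+2 => s top1 == top1)) /=.
rewrite (eq_bigl (fun s : 'S_n.+2 => (s top1 == top1) && tops_last s)); last first.
  by move=> s; rewrite andbC.
rewrite [X in _ + X](eq_bigl (fun s : 'S_n.+2 => (s top1 == top2) && tops_last s)).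
  rewrite !big_lift_perm.
  have lift_last (j : 'I_n.+2) (t : 'S_n.+1) : (n <= j)%N ->
      tops_last (lift_perm top1 j t) = (t ord_max == ord_max) && true.
    move=> le_j; rewrite /tops_last lift_perm_id lift_perm_lift le_j andbT /=.
    have := ltn_ord (t ord_max); rewrite ltnS -val_eqE /= eqn_leq /bump => ->.
    by case: leqP; lia.
  rewrite (eq_bigl _ _ (fun t => lift_last top1 t (leqnSn n))).
  rewrite [X in _ + X](eq_bigl _ _
    (fun t => lift_last top2 t (eq_leq (esym top2E)))).
  rewrite !big_lift_perm -big_split -sumrN; apply: eq_bigr => r _ /=.
  rewrite /weight !odd_lift_perm !word_lift_perm.
  have -> : insert_at (ord_max : 'I_n.+1) (ord_max : 'I_n.+1)
      [seq bump (ord_max : 'I_n.+1) k | k <- word r] = word r ++ [:: n].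
    by rewrite bump_word // insert_max ?size_word.
  rewrite !map_cat !bump_word ?top2E //= /bump ltnn leqnn add0n add1n.
  rewrite !insert_max ?size_cat ?size_word ?addn1 // -!catA /valleys.
  have [-> ->] := valleys_from_tops false (leq0n n) (word_lt r).
  rewrite !addbb addNb addbb !addFb signrN exprS.
  by move: ((-1) ^+ r : rat) (2 ^+ _ : rat) => a b; ring.
move=> s; rewrite andbC /tops_last; case: (ltnP (s top1) n) => [|le_n] /=.
  by rewrite !andbF.
congr (_ && _); apply/idP/eqP => [ne_top|->]; last by rewrite eq_sym neq_lift.
apply: ord_inj; rewrite top2E; move: ne_top (ltn_ord (s top1)).
rewrite -val_eqE /=; lia.
Qed.

Lemma signed_valleys_rec : \sum_(s : 'S_n.+2) weight s = - \sum_(s : 'S_n) weight s.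
Proof. by rewrite (bigID tops_last) /= sum_tops sum_not_tops addr0. Qed.

End SignedValleys.

Lemma signed_valleys n :
  \sum_(s : 'S_n) (-1) ^+ s * 2 ^+ valleys (word s) = (-1) ^+ n./2 :> rat.
Proof.
have trivial_case k : (forall s : 'S_k, s = 1%g) ->
    \sum_(s : 'S_k) (-1) ^+ s * 2 ^+ valleys (word s) = 1 :> rat.
  move=> eq1; rewrite (big_pred1 1%g) => [|s]; last by rewrite [s]eq1 /= eqxx.
  by rewrite odd_perm1 mul1r (eqP (_ : valleys _ == 0%N)) ?valleys_eq0.
have [m] := ubnP n; elim: m n => // m IHm [|[|n]] lt_n.
- by apply: trivial_case => s; apply/permP; case.
- by apply: trivial_case => s; apply/permP => i; rewrite !ord1.
rewrite signed_valleys_rec IHm ?exprS ?mulN1r //; lia.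
Qed.

(** * Derivation of power series, and the unsigned sum of 2^val *)

Definition fps_deriv (K : fieldType) (f : fps K) : fps K :=
  Fps (fun n => n.+1%:R * f n.+1).

Section Deriv.
Variable K : fieldType.
Implicit Types f g : fps K.

Lemma fps_derivD f g : fps_deriv (f + g) = fps_deriv f + fps_deriv g.
Proof. by apply: fpsP => n /=; rewrite mulrDr. Qed.

Lemma fps_derivN f : fps_deriv (- f) = - fps_deriv f.
Proof. by apply: fpsP => n /=; rewrite mulrN. Qed.

Lemma fps_deriv0 : fps_deriv (0 : fps K) = 0.
Proof. by apply: fpsP => n /=; rewrite mulr0. Qed.

Lemma fps_deriv1 : fps_deriv (1 : fps K) = 0.
Proof. by apply: fpsP => n /=; rewrite mulr0. Qed.

Lemma fps_derivM f g : fps_deriv (f * g) = fps_deriv f * g + f * fps_deriv g.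
Proof.
apply: fpsP => n; rewrite fcoefD !fcoefM /=.
transitivity (\sum_(i < n.+2) i%:R * f i * g (n.+1 - i)%N +
              \sum_(i < n.+2) f i * ((n.+1 - i)%:R * g (n.+1 - i)%N)).
  rewrite -big_split mulr_sumr; apply: eq_bigr => i _ /=.
  by rewrite -{1}(subnKC (ltn_ord i : i <= n.+1)%N) natrD; ring.
congr (_ + _).
  by rewrite big_ord_recl mul0r mul0r add0r; apply: eq_bigr.
rewrite big_ord_recr /= subnn mul0r mulr0 addr0; apply: eq_bigr => i _ /=.
by rewrite subSn // -ltnS.
Qed.

Lemma fps_derivX f n : fps_deriv (f ^+ n) = f ^+ n.-1 * fps_deriv f *+ n.
Proof.
elim: n => [|[|n] IHn]; first exact: fps_deriv1.
  by rewrite mul1r.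
by rewrite exprS fps_derivM IHn mulrnAr mulrA -exprS [RHS]mulrS mulrC.
Qed.

Lemma fps_deriv_sum I (r : seq I) (P : pred I) (F : I -> fps K) :
  fps_deriv (\sum_(i <- r | P i) F i) = \sum_(i <- r | P i) fps_deriv (F i).
Proof. exact: (big_morph _ fps_derivD fps_deriv0). Qed.

Lemma fcoef_iter_deriv f n : iter n (@fps_deriv K) f 0 = n`!%:R * f n.
Proof.
(* The induction needs all coefficients of the iterated derivative, not only the constant one. *)
suff E k : iter n (@fps_deriv K) f k * k`!%:R = (n + k)`!%:R * f (n + k)%N.
  by rewrite -[LHS]mulr1 -[1]/(0`!%:R) E addn0.
elim: n k => [|n IHn] k; first by rewrite mulrC.
by rewrite iterS /= mulrAC -natrM -factS mulrC IHn addSnnS.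
Qed.

End Deriv.

Lemma mul_div_fact n (a : rat) : n.+1%:R * (a / n.+1`!%:R) = a / n`!%:R.
Proof.
by rewrite factS natrM invfM mulrCA mulVKf // pnatr_eq0.
Qed.

Lemma fps_deriv_cos : fps_deriv fps_cos = - fps_sin.
Proof.
apply: fpsP => n /=; rewrite uphalf_half; case: (odd n); rewrite ?mulr0 ?oppr0 //.
by rewrite mul_div_fact add1n exprS mulN1r mulNr.
Qed.

Lemma fps_deriv_sin : fps_deriv fps_sin = fps_cos.
Proof.
apply: fpsP => n /=; rewrite uphalf_half; case: (odd n); rewrite ?mulr0 //.
by rewrite mul_div_fact.
Qed.

(** The derivative vanishes, so in characteristic 0 only the constant term survives. *)
Lemma cos2Dsin2 : fps_cos ^+ 2 + fps_sin ^+ 2 = 1.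
Proof.
have deriv0 : fps_deriv (fps_cos ^+ 2 + fps_sin ^+ 2) = 0.
  rewrite fps_derivD !fps_derivX fps_deriv_cos fps_deriv_sin /=; ring.
apply: fpsP => -[|n].
  by rewrite fcoefD !fcoefM !big_ord1 /=.
have /eqP := congr1 (fun f : fps rat => f n) deriv0.
by rewrite /= mulf_eq0 pnatr_eq0 => /eqP.
Qed.

(* Up to the factor sqrt 2, these are sec (x + pi/4) and tan (x + pi/4). *)
Definition fps_sec : fps rat := (fps_cos - fps_sin)^-1.
Definition fps_tan : fps rat := (fps_cos + fps_sin) * fps_sec.

Lemma fps_sec_unit : fps_cos - fps_sin \is a GRing.unit.
Proof. by rewrite fps_unitE. Qed.

Lemma fps_deriv_sec : fps_deriv fps_sec = fps_sec * fps_tan.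
Proof.
have := congr1 (@fps_deriv rat) (mulVr fps_sec_unit).
rewrite -/fps_sec fps_derivM fps_derivD fps_derivN fps_deriv_cos fps_deriv_sin.
rewrite fps_deriv1 => /(canRL (addrK _)) /(canRL (mulrK fps_sec_unit)) ->.
rewrite -/fps_sec /fps_tan; ring.
Qed.

Lemma fps_deriv_tan : fps_deriv fps_tan = 1 + fps_tan ^+ 2.
Proof.
rewrite /fps_tan fps_derivM fps_derivD fps_deriv_cos fps_deriv_sin fps_deriv_sec.
rewrite -(mulVr fps_sec_unit) -/fps_sec /fps_tan; ring.
Qed.

(** With S, T for [fps_sec], [fps_tan] and A = 1 + T^2, the derivative of S A^k T^m is (2k + 1) S
    A^k T^(m+1) + m S A^(k+1) T^(m-1). For m = n - 2k these are the multiplicities of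
    [sum_valleys_lift_max]. *)
Lemma iter_deriv_sec n : iter n (@fps_deriv rat) fps_sec =
  \sum_(s : 'S_n) fps_sec * ((1 + fps_tan ^+ 2) ^+ valleys (word s) *
                             fps_tan ^+ (n - (valleys (word s)).*2)).
Proof.
elim: n => [|n IHn].
  rewrite (big_pred1 1%g) => [|s]; last by symmetry; apply/eqP/permP; case.
  by rewrite (eqP (_ : valleys _ == 0%N)) ?valleys_eq0 // !mulr1.
rewrite iterS IHn fps_deriv_sum big_perm_lift_max; apply: eq_bigr => s _.
have [le_kn sumE] := sum_valleys_lift_max (fun k =>
  fps_sec * ((1 + fps_tan ^+ 2) ^+ k * fps_tan ^+ (n.+1 - k.*2))) s.
rewrite {}sumE; move: (valleys _) le_kn => k le_kn.
have -> : (n.+1 - k.*2 = (n - k.*2).+1)%N by rewrite subSn.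
have -> : (n.+1 - k.+1.*2 = (n - k.*2).-1)%N by lia.
move: (n - k.*2)%N => m {le_kn}.
rewrite !fps_derivM fps_deriv_sec !fps_derivX fps_derivD fps_deriv1 fps_derivX.
rewrite fps_deriv_tan add0r.
move: fps_sec => S; move: (1 + fps_tan ^+ 2) => A; move: fps_tan => T.
case: k m => [|k] [|m]; rewrite /= ?mulr0n -?muln2 ?exprS; ring.
Qed.

(** Constant terms are taken in [iter_deriv_sec]: those of [fps_sec] and [fps_tan] are 1, so 1 + T^2
    becomes 2. *)
Lemma sum_valleys n :
  \sum_(s : 'S_n) 2 ^+ valleys (word s) = n`!%:R * fps_sec n.
Proof.
rewrite -fcoef_iter_deriv iter_deriv_sec fcoef_sum; apply: eq_bigr => s _.
have evalM (f g : fps rat) : (f * g) 0 = f 0 * g 0.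
  by rewrite fcoefM big_ord1.
have evalX (f : fps rat) m : (f ^+ m) 0 = f 0 ^+ m.
  by elim: m => // m IHm; rewrite !exprS evalM IHm.
have sec0 : fps_sec 0 = 1.
  have := congr1 (fun f : fps rat => f 0) (mulVr fps_sec_unit).
  by rewrite evalM mulr1.
have tan0 : fps_tan 0 = 1 by rewrite evalM sec0.
by rewrite !evalM !evalX fcoefD evalX sec0 tan0 !expr1n mul1r mulr1.
Qed.

(** * Signs of snakes over a fixed permutation *)

Lemma valleyN w i : ~~ valley w i = [|| i == 0%N, (nth 0 w i.-1 <= nth 0 w i)%N |
  (i.+1 < size w)%N && (nth 0 w i.+1 < nth 0 w i)%N].
Proof.
rewrite /valley lt0n [(nth 0%N w i.-1 <= _)%N]leqNgt.
by case: (i == _) => //=; rewrite [LHS]negb_and negbK.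
Qed.

(** The entry of larger absolute value decides the comparison by its sign alone. *)
Lemma window_alternates n (p : signed_perm n) (i j : 'I_n) b : i != j ->
  (if b then window p i < window p j else window p j < window p i) =
  (if (p.1 i < p.1 j)%N then p.2 j == ~~ b else p.2 i == b).
Proof.
move=> ne_ij; have : p.1 i != p.1 j :> nat.
  by rewrite (inj_eq val_inj) (inj_eq perm_inj).
rewrite /window; move: (nat_of_ord (p.1 i)) (nat_of_ord (p.1 j)) => a c ne_ac.
by case: b; case: (p.2 i) (p.2 j) => [] []; rewrite ?expr0 ?expr1 ?mul1r ?mulN1r /=;
  case: ltnP => lt_ac; lia.
Qed.

(** Each adjacent pair fixes the sign of its entry of larger absolute value, and positivity fixes
    that of the first entry; the entries so constrained are the non-valleys. *)
Lemma snakeE n (p : signed_perm n) :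
  snake p = [forall i : 'I_n, ~~ valley (word p.1) i ==> (p.2 i == odd i)].
Proof.
apply/andP/forallP => [[/forallP first_gt0 /forallP alt] i | signs].
  have [i0|i_gt0] := posnP i.
    have := implyP (first_gt0 i) (introT eqP i0).
    rewrite i0 ltNge le_eqVlt window_lt0 negb_or.
    by case: (p.2 i); rewrite ?andbF ?implybT.
  apply/implyP; rewrite valleyN size_word gtn_eqF //=.
  case/orP=> [le_w | /andP[lt_i1 lt_w]].
    have lt_pi : (i.-1 < n)%N := leq_ltn_trans (leq_pred i) (ltn_ord i).
    have ne_i : Ordinal lt_pi != i by rewrite -val_eqE /=; lia.
    have := implyP (forallP (alt (Ordinal lt_pi)) i).
    rewrite window_alternates //= prednK // eqxx => /(_ isT).
    rewrite -!(nth_word p.1) /= ltn_neqAle le_w nth_uniq ?uniq_word ?size_word //.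
    by rewrite -val_eqE /= in ne_i; rewrite ne_i /= -[in odd i](prednK i_gt0).
  have := implyP (forallP (alt i) (Ordinal lt_i1)).
  rewrite window_alternates /=; last by rewrite -val_eqE /=; lia.
  by rewrite -!(nth_word p.1) /= ltnNge (ltnW lt_w) => /(_ (eqxx _)).
split; apply/forallP => i.
  apply/implyP => i0; have := implyP (signs i).
  rewrite valleyN i0 /= (eqP i0) => /(_ isT) /eqP ei.
  by rewrite /window ei mul1r.
apply/forallP => j; apply/implyP => /eqP ji.
have ne_ij : i != j by rewrite -val_eqE /= ji; lia.
rewrite window_alternates //; case: ltnP => lt_ij;
  [have := implyP (signs j) | have := implyP (signs i)];
  rewrite valleyN size_word.
  by rewrite ji /= -ji !nth_word ltnW ?orbT //; apply.
apply; rewrite -ji ltn_ord !nth_word.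
rewrite [X in true && X]ltn_neqAle lt_ij andbT /=.
by rewrite (inj_eq val_inj) (inj_eq perm_inj) [j == i]eq_sym ne_ij !orbT.
Qed.

(** [z] marks negative entries. The conditions of [snakeE] are independent, so the sum factors over
    positions; it is used at z = 1 and z = -1. *)
Lemma sum_snake_signs n (s : 'S_n) (z : rat) :
  \sum_(e : {ffun 'I_n -> bool} | snake (s, e)) \prod_i z ^+ e i =
  \prod_(i < n) (if valley (word s) i then 1 + z else z ^+ odd i).
Proof.
rewrite big_mkcond.
transitivity (\sum_(e : {ffun 'I_n -> bool}) \prod_(i < n)
    (if ~~ valley (word s) i ==> (e i == odd i) then z ^+ e i else 0)).
  apply: eq_bigr => e _; rewrite snakeE; case: forallP => [all_ok|not_ok].
    by apply: eq_bigr => i _; rewrite all_ok.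
  have [i bad_i] : exists i : 'I_n, ~~ (~~ valley (word s) i ==> (e i == odd i)).
    by apply/existsP; rewrite -negb_forall; apply/forallP.
  by rewrite (bigD1 i) //= (negbTE bad_i) mul0r.
rewrite -(bigA_distr_bigA (fun (i : 'I_n) (b : bool) =>
  if ~~ valley (word s) i ==> (b == odd i) then z ^+ b else 0)).
apply: eq_bigr => i _; rewrite big_bool /=.
by case: valley; case: (odd i); rewrite /= ?addr0 ?add0r // addrC.
Qed.

(** * The parity of inv_D *)

(** Permuting the columns of the Vandermonde matrix with nodes 0, ..., n-1 multiplies its positive
    determinant by the sign of [s], while the determinant remains the product of the differences of
    nodes. *)
Lemma sign_inversions n (s : 'S_n) :
  (-1) ^+ s = \prod_(i < n) \prod_(j < n | (i < j)%N) Num.sg ((s j)%:Z - (s i)%:Z).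
Proof.
pose V := @Vandermonde int n n (\row_j (j : nat)%:Z).
have -> : (-1) ^+ s = Num.sg (\det (col_perm s V)).
  rewrite col_permE det_mulmx det_perm odd_permV sgrM sgrX sgrN1.
  rewrite gtr0_sg ?mul1r // det_Vandermonde; apply: prodr_gt0 => i _.
  by apply: prodr_gt0 => j lt_ij; rewrite !mxE subr_gt0 ltz_nat.
have -> : col_perm s V = Vandermonde n (\row_j (s j : nat)%:Z).
  by apply/matrixP => i j; rewrite !mxE.
rewrite det_Vandermonde (big_morph _ (@sgrM _) (@sgr1 _)); apply: eq_bigr => i _.
rewrite (big_morph _ (@sgrM _) (@sgr1 _)); apply: eq_bigr => j _.
by rewrite !mxE.
Qed.

(* For i < j, the pair (i, j) counts once in [invD] if |p_i| > |p_j|, and 0 or *)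
(* 2 times if |p_i| < |p_j|. *)
Lemma odd_invD n (p : signed_perm n) : odd (invD p) = odd_perm p.1.
Proof.
apply: (@signr_inj int); rewrite signr_odd sign_inversions exprD -!prodr_const.
rewrite pair_big_dep /= !(eq_bigl _ _ (fun ij => in_set _ ij)).
rewrite !big_mkcondr -big_split.
apply: eq_bigr => -[i j] /= lt_ij.
have : p.1 i != p.1 j :> nat.
  by rewrite (inj_eq val_inj) (inj_eq perm_inj) -val_eqE ltn_eqF.
move: (window p i) (window p j) (absz_window p i) (absz_window p j) => x y.
move: (nat_of_ord (p.1 i)) (nat_of_ord (p.1 j)) => a c xE yE ne_ac.
have -> : Num.sg (c%:Z - a%:Z) = if (a < c)%N then 1 else -1.
  by case: ltnP => lt_ac; [rewrite gtr0_sg | rewrite ltr0_sg]; lia.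
by case: (ltrP y x) => ?; case: (ltrP y (- x)) => ?; case: ltnP => ?; lia.
Qed.

(** * Sums of signs over snakes *)

Lemma sum_snakes n (s : 'S_n) :
  \sum_(e : {ffun 'I_n -> bool} | snake (s, e)) 1 = 2 ^+ valleys (word s) :> rat.
Proof.
transitivity (\sum_(e : {ffun 'I_n -> bool} | snake (s, e))
    \prod_(i < n) 1 ^+ e i : rat).
  by apply: eq_bigr => e _; rewrite big1 // => i _; rewrite expr1n.
rewrite sum_snake_signs valleysE size_word expr_sum; apply: eq_bigr => i _.
by case: valley; rewrite ?expr1n.
Qed.

Lemma prod_signs n : \prod_(i < n) (-1) ^+ odd i = (-1) ^+ n./2 :> rat.
Proof.
elim: n => [|n IHn]; first by rewrite big_ord0.
by rewrite big_ord_recr IHn /= uphalf_half addnC exprD.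
Qed.

(** At z = -1 each valley contributes a factor 0, so only the permutation without valleys
    survives. *)
Lemma sum_signed_snakes n (s : 'S_n) :
  \sum_(e : {ffun 'I_n -> bool} | snake (s, e)) \prod_i (-1) ^+ e i =
  (if s == 1%g then (-1) ^+ n./2 else 0) :> rat.
Proof.
rewrite sum_snake_signs -valleys_eq0 valleysE size_word sum_nat_eq0.
case: forallP => [no_valley | /forallP]; last first.
  rewrite negb_forall => /existsP[i /=]; rewrite eqb0 negbK => v_i.
  by rewrite (bigD1 i) //= v_i subrr mul0r.
rewrite -prod_signs; apply: eq_bigr => i _.
by have := no_valley i; rewrite /= eqb0 => /negbTE ->.
Qed.

Lemma typeD_sign n (p : signed_perm n) :
  (-1) ^+ (~~ typeD p) = \prod_i (-1) ^+ p.2 i :> rat.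
Proof.
rewrite negbK signr_odd -prodr_const big_mkcond; apply: eq_bigr => i _.
by rewrite inE window_lt0; case: (p.2 i).
Qed.

Lemma snake_sum_pair n (w : signed_perm n -> rat) :
  \sum_(p | snake p) w p =
  \sum_(s : 'S_n) \sum_(e : {ffun 'I_n -> bool} | snake (s, e)) w (s, e).
Proof.
by rewrite pair_big_dep /=; apply: eq_big => -[].
Qed.

(** When the product is expanded, the terms in c and cd both reduce to the identity, of sign 1, and
    the term in d is [signed_valleys]. *)
Lemma sum_sgn_snakes n (c d : rat) :
  \sum_(p : signed_perm n | snake p)
    (1 + c * (-1) ^+ (~~ typeD p)) * (1 + d * (-1) ^+ invD p) =
  n`!%:R * fps_sec n + (c + d + c * d) * (-1) ^+ n./2.
Proof.
have invE (p : signed_perm n) : (-1) ^+ invD p = (-1) ^+ p.1 :> rat.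
  by rewrite -signr_odd odd_invD.
rewrite snake_sum_pair -sum_valleys.
transitivity (\sum_(s : 'S_n) (2 ^+ valleys (word s) +
    (c * (if s == 1%g then (-1) ^+ n./2 else 0) +
    (d * ((-1) ^+ s * 2 ^+ valleys (word s)) +
    c * d * (if s == 1%g then (-1) ^+ n./2 else 0)))) : rat).
  apply: eq_bigr => s _.
  under eq_bigr => e _ do rewrite invE typeD_sign /= mulrDl !mulrDr !mul1r !mulr1.
  rewrite !big_split /= -addrA sum_snakes.
  have -> : \sum_(e : {ffun 'I_n -> bool} | snake (s, e)) d * (-1) ^+ s =
      d * (-1) ^+ s * 2 ^+ valleys (word s).
    by rewrite -sum_snakes mulr_sumr; apply: eq_bigr => e _; rewrite mulr1.
  rewrite -mulr_suml -!mulr_sumr sum_signed_snakes.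
  have sgn1 : (if s == 1%g then (-1) ^+ n./2 else 0) * (-1) ^+ s =
      if s == 1%g then (-1) ^+ n./2 else 0 :> rat.
    by case: eqP => [->|_]; rewrite ?odd_perm1 ?mulr1 ?mul0r.
  move: (if _ then _ else _) ((-1) ^+ s) (2 ^+ _) sgn1 => I g V sgn1.
  transitivity (V + (d * g * V + (c * I + c * d * (I * g)))); first by ring.
  by rewrite sgn1; ring.
rewrite !big_split -!mulr_sumr /= signed_valleys -big_mkcond big_pred1_eq /=.
by move: (\sum_s _) ((-1) ^+ n./2 : rat) => A e; ring.
Qed.

(** For c and d equal to 1 or -1 the product on the right is four times the indicator of one
    class. *)
Lemma card_snakes n (P : pred (signed_perm n)) (c d : rat) :
    (forall p, 4 * (P p)%:R =
      (1 + c * (-1) ^+ (~~ typeD p)) * (1 + d * (-1) ^+ odd (invD p))) ->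
  4 * #|[set p | snake p && P p]|%:R =
  n`!%:R * fps_sec n + (c + d + c * d) * (-1) ^+ n./2.
Proof.
move=> PE; rewrite -sum_sgn_snakes -sum1_card natr_sum mulr_sumr.
rewrite big_mkcond [RHS]big_mkcond; apply: eq_bigr => p _.
rewrite -(signr_odd _ (invD p)) -PE inE.
by case: snake; case: (P p); rewrite /= ?mulr1 ?mulr0.
Qed.

(** * The generating functions *)

Lemma fcoefMn (K : fieldType) (f : fps K) m n : (f *+ m) n = f n *+ m.
Proof. by elim: m => // m IHm; rewrite !mulrS fcoefD IHm. Qed.

Lemma sec_mul : fps_sec * (fps_cos - fps_sin) = fps_cos ^+ 2 + fps_sin ^+ 2.
Proof. by rewrite mulVr ?fps_sec_unit // cos2Dsin2. Qed.

(** (-1)^floor(n/2) / n! is the coefficient of cos + sin. *)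
Lemma egf_snakes (a : nat -> nat) (k : rat) :
    (forall n, 4 * (a n)%:R = n`!%:R * fps_sec n + k * (-1) ^+ n./2) ->
  egf a *+ 4 = fps_sec + Fps (fun n => k * (fps_cos + fps_sin) n).
Proof.
move=> aE; apply: fpsP => n; rewrite fcoefMn fcoefD /=.
have fact_neq0 : n`!%:R != 0 :> rat by rewrite pnatr_eq0 -lt0n fact_gt0.
rewrite -[LHS]mulr_natl mulrA aE mulrDl [_ * fps_sec n]mulrC mulfK // -mulrA.
congr (_ + _ * _).
by case: odd; rewrite ?addr0 ?add0r.
Qed.

Lemma egf_snakes_sin (a : nat -> nat) :
    (forall n, 4 * (a n)%:R = n`!%:R * fps_sec n - (-1) ^+ n./2) ->
  egf a = fps_sin ^+ 2 / (2 * (fps_cos - fps_sin)).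
Proof.
move=> aE; have {}aE : egf a *+ 4 = fps_sec - (fps_cos + fps_sin).
  rewrite (@egf_snakes _ (-1)) => [|n]; last by rewrite mulN1r.
  by congr (_ + _); apply: fpsP => n; rewrite /= mulN1r.
have unit2 : (2 : fps rat) \is a GRing.unit by rewrite fps_unitE.
(* With one more factor 2 the left side is [egf a *+ 4] times cos - sin; [sec_mul] then makes both
   sides polynomials in cos and sin. *)
apply: (canRL (mulrK egf_denom_unit)); apply: (mulrI unit2).
transitivity ((egf a *+ 4) * (fps_cos - fps_sin)); first by ring.
by rewrite aE mulrBl sec_mul; ring.
Qed.

Theorem theorem68 :
  egf S_D_plus = (2 * fps_cos ^+ 2 - fps_sin ^+ 2) / (2 * (fps_cos - fps_sin)) /\
  egf S_D_minus = fps_sin ^+ 2 / (2 * (fps_cos - fps_sin)) /\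
  egf S_BD_plus = egf S_BD_minus /\
  egf S_BD_minus = fps_sin ^+ 2 / (2 * (fps_cos - fps_sin)).
Proof.
(* The even classes of each statistic take c or d equal to 1, the odd ones -1; only here is c + d +
   cd = 3. *)
have D_plusE n : 4 * (S_D_plus n)%:R = n`!%:R * fps_sec n + 3 * (-1) ^+ n./2.
  rewrite (@card_snakes _ _ 1 1) => [|p]; first by congr (_ + _ * _).
  by case: typeD; case: odd.
have D_minusE n : 4 * (S_D_minus n)%:R = n`!%:R * fps_sec n - (-1) ^+ n./2.
  rewrite (@card_snakes _ _ 1 (-1)) => [|p]; first by ring.
  by case: typeD; case: odd.
have BD_plusE n : 4 * (S_BD_plus n)%:R = n`!%:R * fps_sec n - (-1) ^+ n./2.
  rewrite (@card_snakes _ _ (-1) 1) => [|p]; first by ring.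
  by case: typeD; case: odd.
have BD_minusE n : 4 * (S_BD_minus n)%:R = n`!%:R * fps_sec n - (-1) ^+ n./2.
  rewrite (@card_snakes _ _ (-1) (-1)) => [|p]; first by ring.
  by case: typeD; case: odd.
rewrite (egf_snakes_sin D_minusE) (egf_snakes_sin BD_plusE).
rewrite (egf_snakes_sin BD_minusE); do !split.
have {}D_plusE : egf S_D_plus *+ 4 = fps_sec + (fps_cos + fps_sin) *+ 3.
  rewrite (egf_snakes D_plusE); congr (_ + _); apply: fpsP => n.
  by rewrite fcoefMn /= mulr_natl.
have unit2 : (2 : fps rat) \is a GRing.unit by rewrite fps_unitE.
apply: (canRL (mulrK egf_denom_unit)); apply: (mulrI unit2).
transitivity ((egf S_D_plus *+ 4) * (fps_cos - fps_sin)); first by ring.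
by rewrite D_plusE mulrDl sec_mul; ring.
Qed.
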